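(* Let $\rho=\sum_I q_I\chi_I$ be an $n$-dimensional diagonal representation of $\mathbb Z_2^k$ with image $F$. (i) The numbers $P_{p,F}$ of primitive $F$-invariant forms of degree $p$ are given by $$P_{0,F}=1,\qquad P_{1,F}=q_\emptyset,\qquad P_{2,F}=\sum_{I\ne\emptyset}\binom{q_I}{2},$$ $$P_{p,F}=\sum_{\{I_1,\dots,I_p\}\in\mathcal A_p}q_{I_1}\cdots q_{I_p}\qquad\text{for }3\le p\le k.$$ Moreover, $P_{p,F}=0$ for any $p>k+1$. (ii) If $k=3$, then $$\begin{aligned}P_{4,F}=\;&q_1q_2q_3q_{123}+q_1q_2q_{13}q_{23}+q_1q_3q_{12}q_{23}+q_1q_{12}q_{13}q_{123}\\&+q_2q_3q_{12}q_{13}+q_2q_{12}q_{23}q_{123}+q_3q_{13}q_{23}q_{123}.\end{aligned}$$ (iii) Let $\beta_p=\dim\Lambda^p_F$ for $0\le p\le n$. Then $$\beta_0=P_{0,F}=1,\qquad \beta_1=P_{1,F},\qquad \beta_2=\binom{q_\emptyset}{2}+P_{2,F},\qquad \beta_3=\binom{q_\emptyset}{3}+q_\emptyset P_{2,F}+P_{3,F},$$ $$\beta_4=\sum_{I\ne\emptyset}\binom{q_I}{4}+\sum_{\emptyset\ne I_1\prec I_2}\binom{q_{I_1}}{2}\binom{q_{I_2}}{2}+q_\emptyset P_{3,F}+\binom{q_\emptyset}{2}P_{2,F}+\binom{q_\emptyset}{4}+P_{4,F}.$$ In particular, if $q_\emptyset=\beta_1=0$, then $$\beta_2=P_{2,F},\qquad\beta_3=P_{3,F},\qquad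 \beta_4=\sum_{I\ne\emptyset}\binom{q_I}{4}+\sum_{\emptyset\ne I_1\prec I_2}\binom{q_{I_1}}{2}\binom{q_{I_2}}{2}+P_{4,F}.$$
   Context: Let $f_1,\dots,f_k$ be the canonical basis of $\mathbb Z_2^k$. For $I\subset\{1,\dots,k\}$, $\chi_I:\mathbb Z_2^k\to\{\pm1\}$ is the character with $\chi_I(f_i)=-1$ if $i\in I$ and $\chi_I(f_i)=1$ if $i\notin I$; thus $\chi_\emptyset=1$ and $\chi_I\chi_J=\chi_{I\triangle J}$. A total order $\prec$ on the subsets of $\{1,\dots,k\}$ is fixed with $\emptyset$ as first element. A diagonal representation of $\mathbb Z_2^k$ is an injective homomorphism $\rho:\mathbb Z_2^k\to\mathrm{GL}_n(\mathbb Z)$ whose image consists of diagonal matrices. Writing $\rho=\sum_I q_I\chi_I$, with $q_I\in\mathbb Z_{\ge0}$ and $\sum_I q_I=n$ (sums over all subsets $I\subset\{1,\dots,k\}$), means that $\rho(f)$ is the diagonal matrix in which, taking the subsets $I$ in the order $\prec$, each entry $\chi_I(f)$ is repeated $q_I$ times. One writes $q_{i_1\dots i_h}$ for $q_{\{i_1,\dots,i_h\}}$. Put $F=\mathrm{Im}(\rho)$. For $p\ge1$, $\mathcal A_p$ is the collection of all unordered $\{I_1,\dots,I_p\}$, with $I_j\subset\{1,\dots,k\}$, such that $\chi_{I_1}\cdots\chi_{I_p}=1$ and no proper (nonempty) subproduct of the $\chi_{I_j}$ equals $1$. $F$ acts on $\mathbb Q^n$ (canonical basis $e_1,\dots,e_n$),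 and $\Lambda^p_F=\Lambda^p(\mathbb Q^n)^F$ is the space of $F$-invariant $p$-forms. For $J=\{j_1<\dots<j_p\}\subset\{1,\dots,n\}$ put $e_J=e_{j_1}\wedge\dots\wedge e_{j_p}$. An $F$-invariant form $e_J$ of degree $p$ is primitive if it cannot be obtained as a wedge product of $F$-invariant forms of degree lower than $p$; $P_{p,F}$ is the number of primitive forms $e_J$ of degree $p$. *)

(* Defs.v *)
From HB Require Import structures.
From mathcomp Require Import all_boot all_order all_algebra.
From mathcomp Require Import boolp.
Set Implicit Arguments.
Unset Strict Implicit.
Unset Printing Implicit Defensive.
Import GRing.Theory.
Local Open Scope ring_scope.

(* The subset {1,...,k} of the mathematics is 'I_k, shifted by one. *)

Definition chi k (I : {set 'I_k}) (f : 'rV['Z_2]_k) : int :=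
  \prod_(i in I) (-1) ^+ (f 0 i).

Lemma chi_basis k (I : {set 'I_k}) (i : 'I_k) :
  chi I (delta_mx 0 i) = if i \in I then -1 else 1.
Proof.
rewrite /chi; case: ifPn => iI.
  rewrite (bigD1 i) //= mxE !eqxx expr1 big1 ?mulr1 // => j /andP[_ ji].
  by rewrite mxE eqxx (negPf ji).
rewrite big1 // => j jI; rewrite mxE eqxx.
by case: eqP jI iI => // -> ->.
Qed.

Lemma chiD k (I : {set 'I_k}) (f g : 'rV['Z_2]_k) :
  chi I (f + g) = chi I f * chi I g.
Proof.
rewrite /chi -big_split; apply: eq_bigr => i _; rewrite mxE /=.
by case: (f 0 i) => [[|[|[]]] ?] //; case: (g 0 i) => [[|[|[]]] ?].
Qed.

Definition subset_order k (prec : rel {set 'I_k}) : Prop :=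
  [/\ irreflexive prec, transitive prec,
      forall I J, I != J -> prec I J || prec J I
    & forall I, I != set0 -> prec set0 I].

Definition preceq k (prec : rel {set 'I_k}) : rel {set 'I_k} :=
  fun I J => (I == J) || prec I J.

Definition diagonal_rep k n (rho : 'rV['Z_2]_k -> 'M[int]_n) : Prop :=
  [/\ forall f, rho f \in unitmx,
      forall f g, rho (f + g) = rho f *m rho g,
      injective rho
    & forall f, is_diag_mx (rho f)].

Definition diag_entries k (prec : rel {set 'I_k}) (q : {set 'I_k} -> nat)
    (f : 'rV['Z_2]_k) : seq int :=
  flatten [seq nseq (q J) (chi J f)
          | J <- sort (preceq prec) (enum {: {set 'I_k}})].

(* The meaning of rho = \sum_I q_I chi_I: the diagonal of rho f lists the
   subsets I in the order prec, each chi_I(f) being repeated q_I times. *)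
Definition rep_sum k n (prec : rel {set 'I_k}) (q : {set 'I_k} -> nat)
    (rho : 'rV['Z_2]_k -> 'M[int]_n) : Prop :=
  (\sum_(I : {set 'I_k}) q I)%N = n
  /\ forall f, rho f = diag_mx (\row_(i < n) (diag_entries prec q f)`_i).

(* [qs q [:: i1; ...; ih]] is q_{i1...ih}, with indices counted from 1. *)
Definition qs k (q : {set 'I_k} -> nat) (s : seq nat) : nat :=
  q [set i : 'I_k | i.+1 \in s].

Definition trivial_subproduct k p (t : p.-tuple {set 'I_k}) (S : {set 'I_p}) :=
  [forall f : 'rV['Z_2]_k, \prod_(j in S) chi (tnth t j) f == 1].

(* An unordered family {I_1,...,I_p}, possibly with repetitions, is encoded by
   its unique nondecreasing enumeration. *)
Definition calA k (prec : rel {set 'I_k}) p : {set p.-tuple {set 'I_k}} :=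
  [set t : p.-tuple {set 'I_k} |
    [&& sorted (preceq prec) t,
        trivial_subproduct t [set: 'I_p]
      & [forall S : {set 'I_p},
          (S != set0) && (S \proper [set: 'I_p]) ==>
            ~~ trivial_subproduct t S]]].

(* A form u is given by its coordinates: u J is the coefficient of
   e_J = e_{j1} /\ ... /\ e_{jp}, J = {j1 < ... < jp} (see [eJE] below). *)
Definition ext n : vectType rat := {ffun {set 'I_n} -> rat^o}.

Definition ext_one n : ext n := [ffun K : {set 'I_n} => (K == set0)%:R].

Definition inversions n (I J : {set 'I_n}) : nat :=
  #|[set x : 'I_n * 'I_n | [&& x.1 \in I, x.2 \in J & (x.2 < x.1)%N]]|.

Definition wedge n (u v : ext n) : ext n :=
  [ffun K : {set 'I_n} =>
     \sum_(I : {set 'I_n} | I \subset K)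
        (-1) ^+ inversions I (K :\: I) * (u I * v (K :\: I))].

Definition wedges n (s : seq (ext n)) : ext n := foldr (@wedge n) (ext_one n) s.

Definition ext_vec n (v : 'cV[rat]_n) : ext n :=
  [ffun K : {set 'I_n} => \sum_(i < n) v i 0 * (K == [set i])%:R].

(* [enum J] lists J in increasing order. *)
Definition eJ n (J : {set 'I_n}) : ext n :=
  wedges [seq ext_vec (delta_mx j 0) | j <- enum J].

(* Lambda(A), where the matrix A acts on Q^n by e_j |-> A e_j *)
Definition ext_act n (A : 'M[int]_n) (u : ext n) : ext n :=
  \sum_(J : {set 'I_n})
     u J *: wedges [seq ext_vec (col j (map_mx intr A)) | j <- enum J].

Lemma ext_act_linear n (A : 'M[int]_n) : linear (ext_act A).
Proof.
move=> a u v; rewrite /ext_act scaler_sumr -big_split; apply: eq_bigr => J _.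
by rewrite !ffunE scalerDl scalerA.
Qed.

HB.instance Definition _ n (A : 'M[int]_n) :=
  GRing.isLinear.Build rat (ext n) (ext n) _ (ext_act A) (ext_act_linear A).

Lemma wedges_basis n (s : seq 'I_n) :
  sorted (fun i j : 'I_n => (i < j)%N) s ->
  wedges [seq ext_vec (delta_mx j 0) | j <- s] =
    [ffun K : {set 'I_n} => (K == [set:: s])%:R] :> ext n.
Proof.
elim: s => [|i s IHs] /= is_sorted.
  by apply/ffunP=> K; rewrite !ffunE.
rewrite IHs ?(path_sorted is_sorted) //.
have i_lt j : j \in s -> (i < j)%N.
  have lt_trans : transitive (fun i j : 'I_n => (i < j)%N).
    by move=> b a c; apply: ltn_trans.
  by have /allP := order_path_min lt_trans is_sorted; apply.
have is_ : i \notin s by apply/negP => /i_lt; rewrite ltnn.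
have vecE I : (ext_vec (delta_mx i 0) : ext n) I = (I == [set i])%:R.
  rewrite ffunE (bigD1 i) //= mxE !eqxx mul1r big1 ?addr0 // => j ji.
  by rewrite mxE (negPf ji) mul0r.
apply/ffunP=> K; rewrite [LHS]ffunE [RHS]ffunE set_cons.
have [->|K_neq] := eqVneq K (i |: [set:: s]).
  have iD : (i |: [set:: s]) :\: [set i] = [set:: s].
    by rewrite setU1K ?inE.
  rewrite (bigD1 [set i]) ?sub1set ?setU11 //= vecE iD ffunE !eqxx !mulr1.
  rewrite big1 => [|I /andP[_ Ii]]; last first.
    by rewrite vecE (negPf Ii) mul0r mulr0.
  suff -> : inversions [set i] [set:: s] = 0%N by rewrite addr0.
  apply/eqP; rewrite cards_eq0; apply/eqP/setP=> -[x y]; rewrite !inE /=.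
  by apply/negP => /and3P[/eqP-> ys]; rewrite ltnNge ltnW ?i_lt.
rewrite big1 // => I IK; rewrite vecE ffunE.
have [Ii|] := eqVneq I [set i]; last by rewrite mul0r mulr0.
have [KI|] := eqVneq (K :\: I) [set:: s]; last by rewrite !mulr0.
by case/eqP: K_neq; rewrite -KI -Ii -{1}(setID K I) (setIidPr IK).
Qed.

Lemma eJE n (J K : {set 'I_n}) : eJ J K = (K == J)%:R.
Proof.
rewrite /eJ wedges_basis; first by rewrite ffunE set_enum.
rewrite (_ : enum J = [seq i <- enum 'I_n | i \in J]); last first.
  by rewrite {1}/enum_mem -enumT.
apply: sorted_filter; first by move=> b a c; apply: ltn_trans.
have := iota_ltn_sorted 0 n; rewrite -val_enum_ord sorted_map; exact.
Qed.

Definition Lambda n p : {vspace ext n} :=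
  (\sum_(J : {set 'I_n} | #|J| == p) <[eJ J]>)%VS.

(* F is a finite family of matrices, given as a list. *)
Definition LambdaF n (F : seq 'M[int]_n) p : {vspace ext n} :=
  (Lambda n p :&: \bigcap_(A <- F) fixedSpace (linfun (ext_act A)))%VS.

Definition betti n (F : seq 'M[int]_n) p : nat := \dim (LambdaF F p).

(* The list of factors is nonempty, so that e_set0 = 1, of degree 0, is not
   excluded as an empty product. *)
Definition primitive n (F : seq 'M[int]_n) p (J : {set 'I_n}) : Prop :=
  [/\ #|J| = p, eJ J \in LambdaF F p
    & ~ exists s : seq (ext n),
        [/\ s != [::],
            forall u, u \in s -> exists2 d, (d < p)%N & u \in LambdaF F d
          & eJ J = wedges s]].

Definition num_primitive n (F : seq 'M[int]_n) p : nat :=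
  #|[set J : {set 'I_n} | `[< primitive F p J >]]|.

(* Main.v *)
(* In the basis e_J the group acts diagonally, and e_J is multiplied by the
   product of the characters of the coordinates in J.  Identifying characters
   with vectors of (Z/2)^k, the invariant p-forms have as basis the e_J for
   which the p vectors sum to zero, and e_J is primitive iff no proper nonempty
   part of J has sum zero: a nonzero coefficient at J in a wedge product exhibits
   such parts.  Two equal vectors already sum to zero, so for p >= 3 a primitive
   J involves p distinct characters, which gives the formulas for P_p; since the
   sums of the subsets of J minus one element are distinct, 2^(p-1) <= 2^k.
   For the Betti numbers, split off the coordinates with trivial character; a
   zero-sum set of four nonzero vectors that is not minimal consists of two pairs
   of equal vectors. *)
Require Import Defs.
From mathcomp Require Import all_boot all_order all_algebra.
From mathcomp Require Import boolp zify ring.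

Set Implicit Arguments.
Unset Strict Implicit.
Unset Printing Implicit Defensive.
Import GRing.Theory.

Local Open Scope ring_scope.

(** * Zero-sum sets and minimal zero-sum sets in an abelian group *)

Section ZeroSums.

Variables (T : finType) (V : zmodType) (v : T -> V).
Implicit Types S U J : {set T}.

Definition zero_sum S := \sum_(j in S) v j == 0.

(** The empty set counts as minimal, in agreement with P_0 = 1. *)
Definition min_zero_sum S :=
  zero_sum S && [forall U : {set T}, (U != set0) && (U \proper S) ==> ~~ zero_sum U].

Lemma min_zero_sumP S :
  reflect (zero_sum S /\ forall U, U != set0 -> U \subset S -> zero_sum U -> U = S)
          (min_zero_sum S).
Proof.
apply: (iffP andP) => -[zS minS]; split=> //.
  move=> U U0 US zU; apply/eqP; rewrite eqEproper US /=.
  by apply/negP => SU; move/forallP/(_ U): minS; rewrite U0 SU zU.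
apply/forallP => U; apply/implyP => /andP[U0 /properP[US [x xS xU]]].
by apply/negP => zU; rewrite (minS U U0 US zU) xS in xU.
Qed.

Lemma zero_sum0 : zero_sum set0.
Proof. by rewrite /zero_sum big_set0. Qed.

Lemma zero_sum1 x : zero_sum [set x] = (v x == 0).
Proof. by rewrite /zero_sum big_set1. Qed.

Lemma zero_sumD U S : U \subset S -> zero_sum U -> zero_sum (S :\: U) = zero_sum S.
Proof.
move=> US /eqP zU; rewrite /zero_sum [in RHS](big_setID U) /=.
by rewrite (setIidPr US) zU add0r.
Qed.

Hypothesis addvv : forall x : V, x + x = 0.

Lemma zero_sum2 x y : x != y -> zero_sum [set x; y] = (v x == v y).
Proof.
move=> xy; rewrite /zero_sum big_setU1 ?inE //= big_set1.
have oppv : - v y = v y by apply/eqP; rewrite eq_sym -addr_eq0 addvv.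
by rewrite addr_eq0 oppv.
Qed.

(** Two elements with the same vector form a zero-sum pair, which minimality would force to be all
    of [S]. *)
Lemma min_zero_sum_inj S : (2 < #|S|)%N -> min_zero_sum S -> {in S &, injective v}.
Proof.
move=> S2 /min_zero_sumP[_ minS] x y xS yS vxy; apply/eqP/negPn/negP => xy.
have S_eq : [set x; y] = S.
  apply: minS; rewrite ?zero_sum2 ?vxy //.
    by apply/set0Pn; exists x; rewrite !inE eqxx.
  by apply/subsetP => z; rewrite !inE => /orP[] /eqP->.
by rewrite -S_eq cards2 xy in S2.
Qed.

(** Adding the two sums counts the common part twice, and it cancels in exponent two. *)
Lemma zero_sum_symdiff U S :
  zero_sum ((U :\: S) :|: (S :\: U)) = (\sum_(j in U) v j == \sum_(j in S) v j).
Proof.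
have oppv (x : V) : - x = x by apply/eqP; rewrite eq_sym -addr_eq0 addvv.
rewrite -subr_eq0 oppv /zero_sum [LHS in LHS == _](big_setID S) /=.
rewrite [\sum_(j in U) _](big_setID S) [\sum_(j in S) _](big_setID U) /=.
rewrite (setIC S U) addrACA addvv add0r.
congr (_ == _); rewrite addrC; congr (_ + _); apply: eq_bigl => x; rewrite !inE.
  by case: (x \in U); case: (x \in S).
by case: (x \in U); case: (x \in S).
Qed.

End ZeroSums.

(* The sums of the subsets of S minus one element are pairwise distinct. *)
Lemma card_min_zero_sum (T : finType) (V : finZmodType) (v : T -> V) S :
  (forall x : V, x + x = 0) -> min_zero_sum v S -> (2 ^ #|S|.-1 <= #|V|)%N.
Proof.
move=> addvv /min_zero_sumP[_ minS].
have [->|[x xS]] := set_0Vmem S.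
  by rewrite cards0 expn0; apply/card_gt0P; exists 0.
have -> : #|S|.-1 = #|S :\ x| by rewrite (cardsD1 x S) xS.
rewrite -card_powerset.
rewrite -(@card_in_imset _ _ (fun U : {set T} => \sum_(j in U) v j)) ?max_card //.
move=> U W; rewrite !inE => US WS /eqP; rewrite -zero_sum_symdiff // => zUW.
(* The symmetric difference is zero-sum and avoids [x], so minimality of [S] forces it to be
   empty. *)
have sub : (U :\: W) :|: (W :\: U) \subset S :\ x.
  by rewrite subUset !(subset_trans (subsetDl _ _)).
have [D0|D0] := eqVneq ((U :\: W) :|: (W :\: U)) set0.
  apply/setP => y; move/setP/(_ y): D0; rewrite !inE.
  by case: (y \in U); case: (y \in W).
have DS := minS _ D0 (subset_trans sub (subsetDl _ _)) zUW.
by move/subsetP/(_ x): sub; rewrite DS xS !inE eqxx => /(_ isT).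
Qed.

Lemma zero_sum_imset (T L : finType) (V : zmodType) (v : L -> V) (h : T -> L)
    (S : {set T}) :
  {in S &, injective h} -> zero_sum v (h @: S) = zero_sum (v \o h) S.
Proof. by move=> h_inj; rewrite /zero_sum big_imset. Qed.

(** An injection matches subsets of [S] with subsets of its image and preserves sums. This carries
    minimality from coordinates to their characters. *)
Lemma min_zero_sum_imset (T L : finType) (V : zmodType) (v : L -> V) (h : T -> L)
    (S : {set T}) :
  {in S &, injective h} -> min_zero_sum v (h @: S) = min_zero_sum (v \o h) S.
Proof.
move=> h_inj.
have inj_sub (U : {set T}) : U \subset S -> {in U &, injective h}.
  by move=> US; apply: (sub_in2 (subsetP US)) h_inj.
apply/min_zero_sumP/min_zero_sumP; rewrite zero_sum_imset // => -[-> minS];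
  split=> // U U0 US zU.
- have /setP hU : h @: U = h @: S.
    by apply: minS; rewrite ?imset_eq0 ?imsetS // zero_sum_imset //; apply: inj_sub.
  apply/eqP; rewrite eqEsubset US; apply/subsetP => x xS.
  have /imsetP[y yU hxy] : h x \in h @: U by rewrite hU imset_f.
  by rewrite (h_inj _ _ xS (subsetP US _ yU) hxy).
(* [W] is the part of [S] lying over [U]; minimality of [S] is applied to it. *)
pose W := S :&: h @^-1: U.
have hW : h @: W = U.
  apply/setP => y; apply/imsetP/idP => [[x]|yU]; first by rewrite !inE => /andP[_ xU] ->.
  have /imsetP[x xS yx] := subsetP US y yU.
  by exists x; rewrite // !inE xS -yx.
rewrite -hW in U0 zU *; rewrite imset_eq0 in U0.
rewrite zero_sum_imset in zU; last exact: inj_sub (subsetIl _ _).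
by have -> : W = S by apply: minS; rewrite ?subsetIl.
Qed.

(** * Counting subsets by the number of elements of each type *)

Section Profile.

Variables (T L : finType) (c : T -> L).

Definition fiber (I : L) : {set T} := [set x | c x == I].

(** A subset is determined by its intersections with the fibers, and these can be chosen
    independently of one another. *)
Lemma card_profile (m : L -> nat) :
  #|[set J : {set T} | [forall I, #|J :&: fiber I| == m I]]|
    = (\prod_I 'C(#|fiber I|, m I))%N.
Proof.
pose F (I : L) := [set A : {set T} | (A \subset fiber I) && (#|A| == m I)].
pose g (J : {set T}) : {ffun L -> {set T}} := [ffun I => J :&: fiber I].
have g_inj : injective g.
  move=> J K /ffunP gJK; apply/setP => x; have := gJK (c x).
  by rewrite !ffunE => /setP/(_ x); rewrite !inE eqxx !andbT.
rewrite -(card_imset _ g_inj).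
transitivity #|family F|.
  apply: eq_card => h; apply/imsetP/familyP => [[J] | hF].
    by rewrite inE => /forallP mJ -> I; rewrite ffunE inE subsetIr mJ.
  (* Since the fibers are disjoint, gluing a family of parts and cutting along the fibers again
     gives the family back. *)
  have hI I : (\bigcup_I h I) :&: fiber I = h I.
    apply/setP => x; rewrite !inE; apply/andP/idP => [[/bigcupP[I' _ xI']]|xI].
      have := hF I'; rewrite inE => /andP[/subsetP/(_ _ xI')].
      by rewrite inE => /eqP-> _ /eqP <-.
    have := hF I; rewrite inE => /andP[/subsetP/(_ _ xI)].
    by rewrite inE => ->; split=> //; apply/bigcupP; exists I.
  exists (\bigcup_I h I); last by apply/ffunP => I; rewrite ffunE hI.
  by rewrite inE; apply/forallP => I; rewrite hI; have := hF I; rewrite inE => /andP[].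
rewrite card_family foldrE big_map big_enum /=.
by apply: eq_bigr => I _; rewrite cards_draws.
Qed.

(** Equality of cardinals makes [c] injective on [J], so [J] has one point over each element of [U]
    and none elsewhere: its profile is the indicator function of [U]. *)
Lemma card_transversals (U : {set L}) :
  #|[set J : {set T} | (#|J| == #|U|) && (c @: J == U)]|
    = (\prod_(I in U) #|fiber I|)%N.
Proof.
rewrite [RHS]big_mkcond /=.
transitivity (\prod_I 'C(#|fiber I|, I \in U))%N; last first.
  by apply: eq_bigr => I _; case: (I \in U); rewrite ?bin1 ?bin0.
rewrite -card_profile; apply: eq_card => J; rewrite !inE.
apply/andP/forallP => [[/eqP JU /eqP cJ] I|Jm].
  have c_inj : {in J &, injective c}.
    by apply/imset_injP; rewrite cJ JU.
  have [IU|IU] := boolP (I \in U).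
    have /imsetP[x xJ Ix] : I \in c @: J by rewrite cJ.
    apply/cards1P; exists x; apply/setP => y; rewrite !inE.
    apply/andP/eqP => [[yJ /eqP yI]|->]; last by rewrite xJ Ix.
    by apply: c_inj; rewrite // yI.
  rewrite cards_eq0; apply/eqP/setP => y; rewrite !inE.
  apply/negP => /andP[yJ /eqP yI]; case/negP: IU.
  by rewrite -cJ -yI imset_f.
have cJ : c @: J = U.
  apply/setP => I; apply/imsetP/idP => [[x xJ ->]|IU].
    have /eqP := Jm (c x); case: (c x \in U) => // /eqP; rewrite cards_eq0.
    by move/eqP/setP/(_ x); rewrite !inE xJ eqxx.
  have := Jm I; rewrite IU => /cards1P[x /setP/(_ x)]; rewrite !inE eqxx.
  by move/andP => [xJ /eqP xI]; exists x.
rewrite cJ eqxx; split=> //; rewrite -cJ eq_sym; apply/imset_injP => x y xJ yJ cxy.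
have := Jm (c x); have -> : c x \in U by rewrite -cJ imset_f.
move/cards1P => [z /setP Jz]; have := Jz x; have := Jz y.
by rewrite !inE xJ yJ cxy eqxx => /esym/eqP-> /esym/eqP->.
Qed.

End Profile.

(** * Characters as vectors of (Z/2)^k *)

Definition indicator k (I : {set 'I_k}) : 'rV['Z_2]_k := \row_i (i \in I)%:R.

Lemma indicator_inj k : injective (@indicator k).
Proof.
move=> I J /rowP IJ; apply/setP => i; have := IJ i; rewrite !mxE.
by case: (i \in I); case: (i \in J).
Qed.

Lemma indicator_eq0 k (I : {set 'I_k}) : (indicator I == 0) = (I == set0).
Proof.
have -> : 0 = indicator (set0 : {set 'I_k}) by apply/rowP => i; rewrite !mxE inE.
by rewrite (inj_eq (@indicator_inj k)).
Qed.

Lemma addvv_Z2 k (w : 'rV['Z_2]_k) : w + w = 0.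
Proof. by apply/rowP => i; rewrite !mxE; case: (w 0 i) => [[|[|[]]] ?] //; apply/eqP. Qed.

(** The character is -1 raised to the standard pairing of [indicator I] with [f]; in this form it
    can be extended to all vectors and is multiplicative in them. *)
Lemma chi_indicator k (I : {set 'I_k}) f :
  chi I f = \prod_i (-1) ^+ (indicator I 0 i * f 0 i)%R.
Proof.
rewrite /chi [LHS]big_mkcond /=; apply: eq_bigr => i _; rewrite mxE.
by case: (i \in I); case: (f 0 i) => [[|[|[]]] ?].
Qed.

(** A product of characters is the character of the sum of their vectors, and the pairing is
    nondegenerate. *)
Lemma trivial_character_sum (T : finType) k (c : T -> {set 'I_k}) (S : {set T}) :
  [forall f, \prod_(j in S) chi (c j) f == 1] = zero_sum (@indicator k \o c) S.
Proof.
pose pair (w f : 'rV['Z_2]_k) : int := \prod_i (-1) ^+ (w 0 i * f 0 i)%R.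
have prodE f : \prod_(j in S) chi (c j) f = pair (\sum_(j in S) indicator (c j)) f.
  rewrite (big_morph (pair^~ f) (id1 := 1) (op1 := *%R)).
  - by apply: eq_bigr => j _; rewrite chi_indicator.
  - move=> w w'; rewrite /pair -big_split; apply: eq_bigr => i _; rewrite mxE mulrDl.
    by case: (w 0 i * _) => [[|[|[]]] ?] //; case: (w' 0 i * _) => [[|[|[]]] ?].
  - by rewrite /pair big1 // => i _; rewrite mxE mul0r.
apply/forallP/eqP => [trivS|S0 f]; last first.
  by rewrite prodE S0 /pair big1 // => i _; rewrite mxE mul0r.
(* Evaluation at the i-th basis vector reads off the i-th coordinate of the sum. *)
apply/rowP => i; have := trivS (delta_mx 0 i).
have deltaE j : (delta_mx 0 i : 'rV['Z_2]_k) 0 j = (j == i)%:R by rewrite mxE eqxx.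
rewrite prodE; move: (\sum_(j in S) _) => w.
rewrite /pair (bigD1 i) // big1 => [|j ji]; last first.
  by rewrite deltaE (negPf ji) mulr0.
rewrite deltaE eqxx !mulr1 [RHS]mxE.
by case: (w 0 i) => [[|[|[]]] ?] // _; apply/eqP.
Qed.

(** * Invariant and primitive forms of a diagonal action *)

Section DiagonalAction.

Variables (n k : nat) (c : 'I_n -> {set 'I_k}) (rho : 'rV['Z_2]_k -> 'M[int]_n).
Hypothesis rhoE : forall f, rho f = diag_mx (\row_i chi (c i) f).

Let v := @indicator k \o c.

Lemma ext_sum (u : ext n) : u = \sum_(J : {set 'I_n}) u J *: eJ J.
Proof.
apply/ffunP => K; rewrite sum_ffunE (bigD1 K) //= ffunE eJE eqxx.
rewrite big1 ?addr0 => [|J JK]; first by rewrite /GRing.scale /= mulr1.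
by rewrite ffunE eJE eq_sym (negPf JK) scaler0.
Qed.

Lemma wedgeZl a (u w : ext n) : wedge (a *: u) w = a *: wedge u w.
Proof.
apply/ffunP => K; rewrite !ffunE scaler_sumr; apply: eq_bigr => I _.
by rewrite ffunE /GRing.scale /= -mulrA mulrCA.
Qed.

Lemma wedgeZr a (u w : ext n) : wedge u (a *: w) = a *: wedge u w.
Proof.
apply/ffunP => K; rewrite !ffunE scaler_sumr; apply: eq_bigr => I _.
by rewrite ffunE /GRing.scale /= (mulrCA (u I)) (mulrCA _ a).
Qed.

Lemma wedgesZ (I : Type) (s : seq I) (a : I -> rat) (u : I -> ext n) :
  wedges [seq a i *: u i | i <- s] = (\prod_(i <- s) a i) *: wedges [seq u i | i <- s].
Proof.
elim: s => [|i s IHs] /=; first by rewrite big_nil scale1r.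
by rewrite IHs wedgeZl wedgeZr scalerA big_cons.
Qed.

(** Each column of [rho f] is a multiple of a basis vector, so every [eJ J] is an eigenvector, with
    the product of the characters of its coordinates as eigenvalue. *)
Lemma ext_act_diag f (u : ext n) K :
  ext_act (rho f) u K = (\prod_(j in K) chi (c j) f)%:~R * u K.
Proof.
rewrite /ext_act sum_ffunE.
have actE (J : {set 'I_n}) : wedges [seq ext_vec (col j (map_mx intr (rho f))) | j <- enum J]
    = (\prod_(j in J) chi (c j) f)%:~R *: eJ J.
  rewrite -big_enum rmorph_prod -wedgesZ; congr wedges; apply: eq_map => j.
  apply/ffunP => L; rewrite !ffunE scaler_sumr; apply: eq_bigr => i _.
  rewrite /GRing.scale /= mulrA; congr (_ * _); rewrite !mxE rhoE !mxE eqxx andbT.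
  by rewrite eq_sym; case: eqP => [->|_]; rewrite ?mulr1 ?mulr0.
rewrite (bigD1 K) //= actE !ffunE eJE eqxx [X in _ + X]big1 ?addr0 => [|J JK].
  by rewrite /GRing.scale /= mulr1 mulrC.
by rewrite actE !ffunE eJE eq_sym (negPf JK) !scaler0.
Qed.

Lemma mem_Lambda p (u : ext n) :
  reflect (forall K, u K != 0 -> #|K| = p) (u \in Lambda n p).
Proof.
apply: (iffP memv_sumP) => [[w wJ ->] K|up].
  rewrite sum_ffunE; apply: contra_neq_eq => Kp; apply: big1 => J /eqP Jp.
  have /vlineP[a ->] := wJ J (introT eqP Jp); rewrite !ffunE eJE.
  by case: eqP => [KJ|_]; rewrite ?scaler0 // KJ Jp eqxx in Kp *.
exists (fun J => u J *: eJ J) => [J _|]; first by rewrite memvZ ?memv_line.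
rewrite {1}[u]ext_sum [RHS]big_mkcond /=; apply: eq_bigr => J _.
by case: eqP => // Jp; have [->|/up//] := eqVneq (u J) 0; rewrite scale0r.
Qed.

Lemma mem_fixed (F : seq 'M[int]_n) (u : ext n) :
  reflect (forall A, A \in F -> ext_act A u = u)
          (u \in \bigcap_(A <- F) fixedSpace (linfun (ext_act A)))%VS.
Proof.
elim: F => [|A F IHF]; first by rewrite big_nil memvf; constructor.
rewrite big_cons; apply: (iffP memv_capP) => [[/fixedSpaceP fA /IHF fF] B|fF].
  by rewrite inE => /predU1P[->|/fF//]; rewrite -[RHS]fA lfunE.
split; first by apply/fixedSpaceP; rewrite lfunE /= fF ?mem_head.
by apply/IHF => B BF; rewrite fF // inE BF orbT.
Qed.

(** The action is diagonal, so invariance is tested one coefficient at a time; a nonzero coefficient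
    cancels and leaves a trivial product of characters. *)
Lemma mem_LambdaF p (u : ext n) :
  reflect (forall K, u K != 0 -> #|K| = p /\ zero_sum v K)
          (u \in LambdaF (codom rho) p).
Proof.
rewrite /LambdaF; apply: (iffP memv_capP) => [[/mem_Lambda up /mem_fixed fu] K uK|uP].
  split; first exact: up.
  rewrite -trivial_character_sum; apply/forallP => f.
  have /ffunP/(_ K) := fu _ (codom_f rho f); rewrite ext_act_diag.
  rewrite -{2}[u K]mul1r => /(mulIf uK)/eqP.
  by rewrite (_ : 1 = 1%:~R) // eqr_int.
split; first by apply/mem_Lambda => K /uP[].
apply/mem_fixed => _ /codomP[f ->]; apply/ffunP => K; rewrite ext_act_diag.
have [->|/uP[_]] := eqVneq (u K) 0; first by rewrite mulr0.
by rewrite -trivial_character_sum => /forallP/(_ f)/eqP->; rewrite mul1r.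
Qed.

Lemma mem_eJ p J : eJ J \in LambdaF (codom rho) p = (#|J| == p) && zero_sum v J.
Proof.
apply/mem_LambdaF/andP => [/(_ J)|[/eqP Jp zJ] K]; last first.
  by rewrite eJE; have [->|_] := eqVneq K J; rewrite ?eqxx.
by rewrite eJE eqxx => /(_ isT)[-> ->]; rewrite eqxx.
Qed.

(** The forms [eJ J] with [J] a zero-sum set of size [p] are a basis of the invariant [p]-forms. *)
Lemma bettiE p : betti (codom rho) p = #|[set J : {set 'I_n} | (#|J| == p) && zero_sum v J]|.
Proof.
set Z := [set J | _]; pose X := [tuple of [seq (eJ J : ext n) | J <- enum Z]].
rewrite /betti; apply: (@size_basis _ _ _ _ X); apply/andP; split.
  rewrite eqEsubv; apply/andP; split.
    apply/span_subvP => u /mapP[J]; rewrite mem_enum inE => JZ ->.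
    by rewrite mem_eJ.
  apply/subvP => u /mem_LambdaF uZ; rewrite [u]ext_sum; apply: memv_suml => J _.
  have [->|/uZ[/eqP Jp zJ]] := eqVneq (u J) 0; first by rewrite scale0r mem0v.
  by rewrite memvZ ?memv_span // map_f // mem_enum inE Jp.
(* Evaluation at the i-th set of the list isolates the i-th coefficient of the combination. *)
apply/freeP => a a0 i; have /ffunP/(_ (nth set0 (enum Z) i)) := a0.
rewrite sum_ffunE (bigD1 i) //= [X in _ + X]big1 ?addr0 => [|j ji].
  by rewrite !ffunE (nth_map set0) -?cardE // eJE eqxx /GRing.scale /= mulr1.
rewrite !ffunE (nth_map set0) -?cardE // eJE nth_uniq ?enum_uniq -?cardE //.
by rewrite val_eqE eq_sym (negPf ji) scaler0.
Qed.

(** A nonzero coefficient at [K] comes from a splitting of [K] among the factors with nonzero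
    coefficients at the parts. As [K] is nonempty, some factor receives a nonempty part. *)
Lemma wedges_neq0 (s : seq (ext n)) K :
  K != set0 -> wedges s K != 0 ->
  exists2 u, u \in s & exists2 I, I != set0 /\ I \subset K & u I != 0.
Proof.
move=> K0; elim: s => [|u s IHs] /=; first by rewrite ffunE (negPf K0) eqxx.
have [I /and3P[IK uI sI] _|none] := pickP (fun I : {set 'I_n} =>
    [&& I \subset K, u I != 0 & wedges s (K :\: I) != 0]); last first.
  rewrite ffunE big1 ?eqxx // => I IK; have := none I; rewrite IK /=.
  by case: eqP => [->|_ /=]; rewrite ?mul0r ?mulr0 // => /negbFE/eqP->; rewrite !mulr0.
have [I0|I0] := eqVneq I set0.
  rewrite I0 setD0 in sI; have [w ws wP] := IHs sI.
  by exists w; rewrite // inE ws orbT.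
by exists u; rewrite ?mem_head //; exists I.
Qed.

(** The scalar on the first factor cancels the sign of the shuffle that sorts [S] followed by
    [R]. *)
Lemma eJ_setU (S R : {set 'I_n}) :
  [disjoint S & R] -> eJ (S :|: R) = wedges [:: (-1) ^+ inversions S R *: eJ S; eJ R].
Proof.
move=> SR; have oneE K : ext_one n K = (K == set0)%:R by rewrite ffunE.
have wedge1 : wedge (eJ R) (ext_one n) = eJ R.
  apply/ffunP => K; rewrite ffunE (bigD1 K) //= big1 ?addr0 => [|I /andP[IK neqI]].
    rewrite setDv oneE eqxx mulr1 /inversions.
    by rewrite (_ : [set x | _] = set0) ?cards0 ?mul1r //; apply/setP => x; rewrite !inE andbF.
  rewrite oneE setD_eq0; case: (boolP (K \subset I)) => [KI|_]; last by rewrite !mulr0.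
  by rewrite eqEsubset IK KI in neqI.
rewrite /= wedge1 wedgeZl; apply/ffunP => K; rewrite !ffunE eJE.
have [->|KSR] := eqVneq K (S :|: R).
  have RE : (S :|: R) :\: S = R by rewrite setDUl setDv set0U; apply/setDidPl; rewrite disjoint_sym.
  rewrite (bigD1 S) ?subsetUl //= RE !eJE !eqxx !mulr1 big1 ?addr0 => [|I /andP[_ neqI]].
    by rewrite /GRing.scale /= -expr2 sqrr_sign.
  by rewrite eJE (negPf neqI) mul0r mulr0.
rewrite big1 ?scaler0 // => I IK; rewrite !eJE.
have [IS|_] := eqVneq I S; last by rewrite mul0r mulr0.
have [IR|_] := eqVneq (K :\: I) R; last by rewrite !mulr0.
by case/eqP: KSR; rewrite -IR -IS -{1}(setID K I) (setIidPr IK).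
Qed.

(** A proper nonempty zero-sum part and its complement factor [eJ J] into invariant forms of lower
    degree. Conversely, a factorization yields a nonempty zero-sum part with fewer than [p]
    elements. *)
Lemma primitiveE p J :
  `[< primitive (codom rho) p J >] = (#|J| == p) && min_zero_sum v J.
Proof.
apply/asboolP/andP => [[Jp zJ nprod]|[/eqP Jp /min_zero_sumP[zJ minJ]]].
  split; first by rewrite Jp.
  move: zJ; rewrite mem_eJ => /andP[_ zJ].
  apply/min_zero_sumP; split=> // S S0 SJ zS; apply/eqP/negPn/negP => neqS.
  have prS : S \proper J by rewrite properEneq neqS.
  case: nprod; exists [:: (-1) ^+ inversions S (J :\: S) *: eJ S; eJ (J :\: S)]; split=> //.
    move=> u; rewrite !inE => /orP[] /eqP->.
      exists #|S|; first by rewrite -Jp proper_card.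
      by rewrite memvZ // mem_eJ eqxx.
    exists #|J :\: S|; last by rewrite mem_eJ eqxx zero_sumD.
    by rewrite -Jp -(cardsID S J) (setIidPr SJ) -[ltnLHS]add0n ltn_add2r card_gt0.
  rewrite -eJ_setU ?setID; first by rewrite -{1}(setID J S) (setIidPr SJ).
  by rewrite disjoints_subset subsetC subsetDr.
split; rewrite ?mem_eJ ?Jp ?eqxx // => -[s [s0 sP eJs]].
(* For empty [J] the degree is 0, and a nonempty list of factors would need one of negative
   degree. *)
have [J0|J0] := eqVneq J set0.
  by case: s s0 sP {eJs} => // u s _ /(_ u (mem_head _ _)) [d]; rewrite -Jp J0 cards0.
have [|u us [S [S0 SJ] uS]] := @wedges_neq0 s J J0; first by rewrite -eJs eJE eqxx.
have [d dp /mem_LambdaF/(_ S uS)[Sd zS]] := sP u us.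
by move: dp; rewrite -Sd (minJ S) // Jp ltnn.
Qed.

End DiagonalAction.

(** * From the representation to the types of the coordinates *)

Local Open Scope nat_scope.

(** Listing the subsets themselves in place of their character values, in the same order and with
    the same multiplicities, gives the type of each coordinate independently of [f]. *)
Lemma rep_sum_types k n (prec : rel {set 'I_k}) q (rho : 'rV['Z_2]_k -> 'M[int]_n) :
  rep_sum prec q rho ->
  exists c : 'I_n -> {set 'I_k},
    (forall f, rho f = diag_mx (\row_i chi (c i) f)) /\ forall I, #|fiber c I| = q I.
Proof.
move=> [sum_q rhoE].
set s := sort (preceq prec) (enum {: {set 'I_k}}) in rhoE.
have s_enum : perm_eq s (index_enum {set 'I_k}).
  by apply: uniq_perm => [||I];
    rewrite ?sort_uniq ?enum_uniq ?index_enum_uniq // mem_sort mem_enum mem_index_enum.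
pose types := flatten [seq nseq (q J) J | J <- s].
have count_types I : count_mem I types = q I.
  rewrite count_flatten -map_comp sumnE big_map (perm_big _ s_enum) (bigD1 I) //= big1 => [|J JI].
    by rewrite count_nseq /= eqxx mul1n addn0.
  by rewrite count_nseq /= (negPf JI).
have size_types : size types == n.
  rewrite size_flatten /shape -map_comp sumnE big_map (perm_big _ s_enum) -sum_q.
  by apply/eqP; apply: eq_bigr => J _; rewrite /= size_nseq.
exists (tnth (Tuple size_types)); split=> [f|I].
  rewrite rhoE; congr diag_mx; apply/rowP => i; rewrite !mxE (tnth_nth set0) /=.
  rewrite -(nth_map set0 0%R (fun J => chi J f)) ?(eqP size_types) // map_flatten -map_comp.
  by congr (_ `_ i)%R; congr flatten; apply: eq_map => J; rewrite /= map_nseq.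
have -> : q I = count_mem I [seq tnth (Tuple size_types) i | i <- enum 'I_n].
  by rewrite map_tnth_enum count_types.
by rewrite count_map cardE size_filter -enumT; apply: eq_count => i; rewrite /= inE.
Qed.

(** * Counting zero-sum sets of coordinates by their types *)

Section Counting.

Variables (T : finType) (k : nat) (c : T -> {set 'I_k}).
Let v := @indicator k \o c.
Let Z := fiber c set0.
Let q I := #|fiber c I|.
Implicit Types J : {set T}.

Definition profile (m : {set 'I_k} -> nat) :=
  [set J : {set T} | [forall I, #|J :&: fiber c I| == m I]].

Definition num_min p := #|[set J : {set T} | (#|J| == p) && min_zero_sum v J]|.

Definition num_zero p := #|[set J : {set T} | (#|J| == p) && zero_sum v J]|.

Definition num_zero_reduced p :=
  #|[set J : {set T} | [&& #|J| == p, zero_sum v J & [disjoint J & Z]]]|.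

Lemma profileP m J : reflect (forall I, #|J :&: fiber c I| = m I) (J \in profile m).
Proof. by rewrite inE; apply: (iffP forallP) => Jm I; apply/eqP; rewrite Jm. Qed.

(** A set has only one profile, so distinct profiles give disjoint collections and the counts add
    up. *)
Lemma card_bigcup_profile (D : finType) (P : pred D) (m : D -> {set 'I_k} -> nat) :
  (forall i j, P i -> P j -> m i =1 m j -> i = j) ->
  #|\bigcup_(i | P i) profile (m i)| = \sum_(i | P i) \prod_I 'C(q I, m i I).
Proof.
move=> m_inj; rewrite -sum1_card.
under [RHS]eq_bigr do rewrite -card_profile -sum1_card.
(* Extension by the empty collection outside [P] makes disjointness hold for all pairs of
   indices. *)
pose F i := if P i then profile (m i) else set0.
have -> : \bigcup_(i | P i) profile (m i) = \bigcup_i F i by rewrite big_mkcond.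
rewrite partition_disjoint_bigcup => [|i j ij].
  rewrite [RHS]big_mkcond; apply: eq_bigr => i _; rewrite /F.
  by case: (P i); rewrite // big_set0.
rewrite /F; case: (boolP (P i)) => Pi; last by rewrite -setI_eq0 set0I.
case: (boolP (P j)) => Pj; last by rewrite -setI_eq0 setI0.
rewrite -setI_eq0; apply: contraT => /set0Pn[J /setIP[/profileP mi /profileP mj]].
 case/eqP: ij; apply: m_inj => // I.
by rewrite -mi mj.
Qed.

Lemma card_fibers (J : {set T}) : #|J| = \sum_I #|J :&: fiber c I|.
Proof.
rewrite -sum1_card (partition_big c predT) //=; apply: eq_bigr => I _.
by rewrite -sum1_card; apply: eq_bigl => j; rewrite !inE.
Qed.

(** Each type contributes an even multiple of one vector, which vanishes in exponent two. *)
Lemma zero_sum_even_profile m J :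
  (forall I, ~~ odd (m I)) -> J \in profile m -> zero_sum v J.
Proof.
move=> m_even /profileP Jm; rewrite /zero_sum (partition_big c predT) //=.
apply/eqP/big1 => I _; rewrite (eq_bigr (fun=> indicator I)) => [|j /andP[_ /eqP <-]//].
rewrite (eq_bigl (mem (J :&: fiber c I))) => [|j]; last by rewrite !inE.
rewrite sumr_const Jm -[m I]odd_double_half (negPf (m_even I)) add0n -muln2 mulnC.
by rewrite mulrnA mulr2n addvv_Z2 mul0rn.
Qed.

Lemma disjoint_zero_fiber (J : {set T}) : [disjoint J & Z] = (#|J :&: Z| == 0).
Proof. by rewrite cards_eq0 setI_eq0. Qed.

Lemma zero_sum1_fiber x : zero_sum v [set x] = (x \in Z).
Proof. by rewrite zero_sum1 inE /= indicator_eq0. Qed.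

(** Two vectors with sum zero are equal, so both coordinates have the same type [I]; [(I' == I).*2]
    is the resulting profile. *)
Lemma zero_sum_pair (J : {set T}) : #|J| = 2 -> zero_sum v J ->
  exists2 I, I \in c @: J & forall I', #|J :&: fiber c I'| = (I' == I).*2.
Proof.
move=> /eqP/cards2P[x [y [xy ->]]]; rewrite zero_sum2 //; last exact: addvv_Z2.
rewrite (inj_eq (@indicator_inj k)) => /eqP cxy.
exists (c x) => [|I]; first by rewrite imset_f // !inE eqxx.
have [->|Ix] := eqVneq I (c x).
  rewrite (setIidPl _) ?cards2 ?xy //.
  by apply/subsetP => z; rewrite !inE => /orP[] /eqP->; rewrite ?cxy.
apply/eqP; rewrite cards_eq0; apply/eqP/setP => z; rewrite !inE.
apply/negP => /andP[/orP[] /eqP-> /eqP]; rewrite -?cxy => zI.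
  by rewrite zI eqxx in Ix.
by rewrite zI eqxx in Ix.
Qed.

Lemma num_min0 : num_min 0 = 1.
Proof.
rewrite -(cards1 (set0 : {set T})); apply: eq_card => J; rewrite !inE cards_eq0.
apply/andb_idr => /eqP->; apply/min_zero_sumP; split; first exact: zero_sum0.
by move=> U U0; rewrite subset0 (negPf U0).
Qed.

Lemma num_min1 : num_min 1 = q set0.
Proof.
rewrite /q -(card_imset _ (@set1_inj T)); apply: eq_card => J; rewrite inE.
apply/andP/imsetP => [[/cards1P[x ->] /andP[]]|[x xZ ->]].
  by rewrite zero_sum1_fiber => xZ _; exists x.
rewrite cards1; split=> //; apply/min_zero_sumP; rewrite zero_sum1_fiber; split=> // U U0.
by rewrite subset1 (negPf U0) orbF => /eqP.
Qed.

(** A coordinate of trivial character is a zero-sum set by itself. *)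
Lemma min_zero_sum_disjoint J : 1 < #|J| -> min_zero_sum v J -> [disjoint J & Z].
Proof.
move=> J1 /min_zero_sumP[_ minJ]; apply/pred0P => x; apply/negP => /andP[/= xJ xZ].
have xJ' : [set x] = J.
  by apply: minJ; rewrite ?zero_sum1_fiber ?sub1set //; apply/set0Pn; exists x; rewrite inE.
by rewrite -xJ' cards1 in J1.
Qed.

(** Both [U] and its complement in [J] are nonempty and zero-sum, and neither can be a singleton
    because no vector in [J] is zero. *)
Lemma proper_zero_sum_card J U : [disjoint J & Z] -> zero_sum v J ->
  U != set0 -> U \proper J -> zero_sum v U -> 1 < #|U| < #|J|.-1.
Proof.
move=> JZ zJ U0 UJ zU; have US := proper_sub UJ.
have card1 (W : {set T}) : W \subset J -> zero_sum v W -> #|W| != 1.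
  move=> WJ zW; apply/negP => /cards1P[x xW]; move: zW WJ; rewrite xW zero_sum1_fiber sub1set.
  by move=> xZ xJ; move/pred0P/(_ x): JZ; rewrite /= xJ xZ.
have := card1 U US zU; have := card1 (J :\: U) (subsetDl _ _).
rewrite zero_sumD // => /(_ zJ); rewrite cardsDS //.
have := proper_card UJ; have : 0 < #|U| by rewrite card_gt0.
by lia.
Qed.

(** A proper zero-sum part would have at least two elements and leave at least two, which at most
    three coordinates do not allow. *)
Lemma num_min_reduced p : 1 < p <= 3 -> num_min p = num_zero_reduced p.
Proof.
move=> /andP[p1 p3]; apply: eq_card => J; rewrite !inE; case: eqP => //= Jp.
apply/idP/andP => [minJ|[zJ JZ]].
  by rewrite min_zero_sum_disjoint ?Jp //; case/andP: minJ.
apply/min_zero_sumP; split=> // U U0 UJ zU; apply/eqP/negPn/negP => neqU.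
have prU : U \proper J by rewrite properEneq neqU.
by have := proper_zero_sum_card JZ zJ U0 prU zU; rewrite Jp; lia.
Qed.

Lemma num_zero_reduced0 : num_zero_reduced 0 = 1.
Proof.
rewrite -(cards1 (set0 : {set T})); apply: eq_card => J; rewrite !inE cards_eq0.
by apply/andb_idr => /eqP->; rewrite zero_sum0 -setI_eq0 set0I eqxx.
Qed.

Lemma num_zero_reduced1 : num_zero_reduced 1 = 0.
Proof.
apply/eqP; rewrite cards_eq0; apply/eqP/setP => J; rewrite !inE; apply/negP.
case/and3P => /cards1P[x ->]; rewrite zero_sum1_fiber => xZ /pred0P/(_ x).
by rewrite /= inE eqxx xZ.
Qed.

Lemma num_zero_reduced2 : num_zero_reduced 2 = \sum_(I | I != set0) 'C(q I, 2).
Proof.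
(* Each summand counts the sets with two coordinates of type [I] and no others. *)
transitivity (\sum_(I : {set 'I_k} | I != set0) \prod_I' 'C(q I', (I' == I).*2)); last first.
  by apply: eq_bigr => I _; rewrite (bigD1 I) //= eqxx big1 ?muln1 // => I' /negPf->; rewrite bin0.
rewrite -card_bigcup_profile => [|I I' _ _ /(_ I)]; last first.
  by rewrite eqxx; case: eqP.
apply: eq_card => J; rewrite inE; apply/and3P/bigcupP => [[/eqP J2 zJ JZ]|[I I0 mJ]].
  have [I /imsetP[x xJ Ix] mI] := zero_sum_pair J2 zJ.
  exists I; last by apply/profileP.
  apply: contraTneq JZ => I0; rewrite disjoint_zero_fiber mI I0 eqxx //.
split.
- rewrite card_fibers (bigD1 I) //= big1 => [|I' /negPf nI].
    by rewrite (profileP _ _ mJ) eqxx.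
  by rewrite (profileP _ _ mJ) nI.
- by apply: zero_sum_even_profile mJ => I'; rewrite odd_double.
- by rewrite disjoint_zero_fiber (profileP _ _ mJ) (eq_sym set0) (negPf I0).
Qed.

(** Coordinates in [Z] have vector zero, so the part of [J] in [Z] is arbitrary and its removal
    keeps the sum; [a] is the size of this part. *)
Lemma num_zeroE p : num_zero p = \sum_(0 <= a < p.+1) 'C(q set0, a) * num_zero_reduced (p - a).
Proof.
rewrite big_mkord.
have Zsum (W : {set T}) : W \subset Z -> zero_sum v W.
  move=> /subsetP WZ; apply/eqP/big1 => x /WZ; rewrite inE => /eqP cx.
  by apply/eqP; rewrite /= indicator_eq0 cx.
(* On sets of size [p], [inord] keeps the value, since the intersection with [Z] has at most [p]
   elements. *)
rewrite /num_zero -sum1_card (partition_big (fun J => inord #|J :&: Z| : 'I_p.+1) predT) //=.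
apply: eq_bigr => a _; rewrite sum1dep_card -cards_draws -cardsX.
pose f (J : {set T}) := (J :&: Z, J :\: Z).
have f_inj : injective f by move=> J K [JI JD]; rewrite -[J](setID _ Z) JI JD setID.
rewrite -[LHS](card_imset _ f_inj); apply: eq_card => -[A B]; rewrite !inE /=.
have ap : a <= p by rewrite -ltnS.
apply/imsetP/andP => [[J]|[/andP[AZ /eqP Aa] /and3P[Bp zB BZ]]].
  rewrite !inE => /andP[/andP[/eqP Jp zJ] /eqP Ja] [-> ->].
  have JZa : #|J :&: Z| = a by rewrite -Ja inordK // ltnS -Jp subset_leq_card ?subsetIl.
  rewrite subsetIr JZa cardsD JZa Jp !eqxx disjoints_subset subsetDr andbT /=.
  have -> : J :\: Z = J :\: (J :&: Z) by rewrite setDIr setDv set0U.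
  by rewrite zero_sumD ?subsetIl ?zJ //; apply/Zsum/subsetIr.
have AB0 : A :&: B = set0.
  by apply/eqP; rewrite setI_eq0 disjoint_sym; apply: disjointWr BZ.
have IZ : (A :|: B) :&: Z = A.
  by rewrite setIUl (setIidPl AZ) (disjoint_setI0 BZ) setU0.
have DZ : (A :|: B) :\: Z = B.
  rewrite setDUl (_ : A :\: Z = set0) ?set0U; first exact/setDidPl.
  by apply/eqP; rewrite setD_eq0.
exists (A :|: B); last by rewrite /f IZ DZ.
rewrite !inE IZ Aa inord_val eqxx andbT cardsU AB0 cards0 subn0 Aa (eqP Bp) subnKC // eqxx /=.
rewrite -(@zero_sumD _ _ v A) ?subsetUl ?(Zsum A) // setDUl setDv set0U.
by rewrite (setDidPl _) // -setI_eq0 setIC AB0.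
Qed.

Lemma min_zero_sum_type_inj J : 2 < #|J| -> min_zero_sum v J -> {in J &, injective c}.
Proof.
move=> J2 minJ x y xJ yJ cxy.
by apply: (min_zero_sum_inj (@addvv_Z2 k) J2 minJ) => //; congr indicator.
Qed.

(** The coordinates of a minimal set have distinct types here. Sorting by the set [U] of types, the
    minimal sets over [U] are exactly its transversals. *)
Lemma num_min_types p : 2 < p ->
  num_min p =
    \sum_(U : {set {set 'I_k}} | (#|U| == p) && min_zero_sum (@indicator k) U)
       \prod_(I in U) q I.
Proof.
move=> p2; rewrite /num_min -sum1_card.
rewrite (partition_big (fun J => c @: J)
  (fun U => (#|U| == p) && min_zero_sum (@indicator k) U)) /= => [|J]; last first.
  rewrite inE => /andP[/eqP Jp minJ].
  have c_inj : {in J &, injective c} by apply: min_zero_sum_type_inj; rewrite ?Jp.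
  by rewrite card_in_imset // Jp eqxx min_zero_sum_imset.
apply: eq_bigr => U /andP[/eqP Up minU]; rewrite -card_transversals sum1dep_card.
apply: eq_card => J; rewrite !inE Up andbC [RHS]andbC.
case: eqP => // cJ /=; case: eqP => //= Jp.
by rewrite -min_zero_sum_imset ?cJ //; apply/imset_injP; rewrite cJ Up Jp.
Qed.

(** A minimal set of size [p] would give 2^(p-1) <= 2^k. *)
Lemma num_min_gt p : k.+1 < p -> num_min p = 0.
Proof.
move=> kp; apply/eqP; rewrite cards_eq0; apply/eqP/setP => J; rewrite !inE.
apply/negP => /andP[/eqP Jp /(card_min_zero_sum (@addvv_Z2 k))].
rewrite Jp card_mx mul1n card_ord leq_exp2l //; lia.
Qed.

(** A nonminimal zero-sum set of four coordinates with nonzero vectors splits into two zero-sum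
    pairs, each of a single type. The two sums correspond to equal and to distinct types of the
    pairs. *)
Lemma num_zero_reduced4 (prec : rel {set 'I_k}) : subset_order prec ->
  num_zero_reduced 4 = num_min 4
    + (\sum_(I : {set 'I_k} | I != set0) 'C(q I, 4)
      + \sum_(I1 : {set 'I_k} | I1 != set0)
          \sum_(I2 : {set 'I_k} | prec I1 I2) 'C(q I1, 2) * 'C(q I2, 2)).
Proof.
case=> prec_irr prec_trans prec_total prec0.
(* Each unordered pair of types is listed once, smaller type first. As the empty set comes first in
   [prec], the second type is nonempty too. *)
pose P (x : {set 'I_k} * {set 'I_k}) := (x.1 != set0) && preceq prec x.1 x.2.
(* Pairs with I1 = I2 give 4 coordinates of one type, the others 2 + 2. *)
pose m (x : {set 'I_k} * {set 'I_k}) I := ((I == x.1) + (I == x.2)).*2.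
(* The profile determines the unordered pair, and asymmetry of [prec] rules out an exchange of two
   distinct types. *)
have m_inj x y : P x -> P y -> m x =1 m y -> x = y.
  case: x y => [x1 x2] [y1 y2] /andP[_ /= x12] /andP[_ /= y12] mxy.
  have mE I : (I == x1) + (I == x2) = (I == y1) + (I == y2) by apply/double_inj/mxy.
  have := mE x1; have := mE x2; rewrite !eqxx.
  have [->|xy1] := eqVneq x1 y1.
    by have [-> //|] := eqVneq x2 y2; case: (x2 == y1).
  have [xy2|] := eqVneq x1 y2; last by case: (x1 == x2).
  have := mE y1; rewrite eqxx [y1 == x1]eq_sym (negPf xy1).
  have [yx2 _ _ _|//] := eqVneq y1 x2.
  move: x12 y12; rewrite /preceq -xy2 yx2; have [-> //|x12] := eqVneq x1 x2.
  move=> lt12 /(prec_trans _ _ _ lt12).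
  by rewrite prec_irr.
have sumE : \sum_(x | P x) \prod_I 'C(q I, m x I) =
    \sum_(I : {set 'I_k} | I != set0) 'C(q I, 4)
    + \sum_(I1 : {set 'I_k} | I1 != set0)
        \sum_(I2 : {set 'I_k} | prec I1 I2) 'C(q I1, 2) * 'C(q I2, 2).
  rewrite -(pair_big_dep (fun I => I != set0) (preceq prec)
    (fun I1 I2 => \prod_I 'C(q I, m (I1, I2) I))) /=.
  rewrite -big_split; apply: eq_bigr => I1 _ /=.
  rewrite (bigD1 I1) /=; last by rewrite /preceq eqxx.
  congr (_ + _).
    by rewrite (bigD1 I1) //= /m /= !eqxx big1 ?muln1 // => I /negPf->; rewrite bin0.
  apply: eq_big => [I2|I2 /andP[_ I21]].
    by rewrite /preceq eq_sym; have [->|_] := eqVneq I2 I1; rewrite ?prec_irr ?andbF ?andbT.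
  rewrite (bigD1 I1) //= (bigD1 I2) //= /m /= !eqxx eq_sym (negPf I21) mulnA.
  by rewrite big1 ?muln1 // => I /andP[/negPf-> /negPf->]; rewrite bin0.
rewrite -sumE -card_bigcup_profile //.
rewrite /num_zero_reduced -(cardsID [set J | min_zero_sum v J]); congr (_ + _).
  apply: eq_card => J; rewrite !inE andbC; case: eqP => //= J4; rewrite ?andbF //.
  case: (boolP (min_zero_sum _ J)) => [minJ|_]; rewrite ?andbF //=.
  by rewrite (min_zero_sum_disjoint _ minJ) ?J4 //; case/andP: minJ => ->.
apply: eq_card => J; rewrite !inE; apply/and4P/bigcupP => [[nminJ /eqP J4 zJ JZ]|].
  have [U [U0 prU zU]] : exists U : {set T}, [/\ U != set0, U \proper J & zero_sum v U].
    move: nminJ; rewrite /min_zero_sum zJ /= negb_forall => /existsP[U].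
    by rewrite negb_imply negbK => /andP[/andP[U0 prU] zU]; exists U.
  have U2 : #|U| = 2.
    by have := proper_zero_sum_card JZ zJ U0 prU zU; rewrite J4; case: #|U| => [|[|[|[]]]].
  have UJ := proper_sub prU.
  have D2 : #|J :\: U| = 2 by rewrite cardsDS // J4 U2.
  have [I1 /imsetP[x1 x1U I1x] mI1] := zero_sum_pair U2 zU.
  have [I2 /imsetP[x2 x2D I2x] mI2] : exists2 I, I \in c @: (J :\: U)
      & forall I', #|(J :\: U) :&: fiber c I'| = (I' == I).*2.
    by apply: zero_sum_pair D2 _; rewrite zero_sumD.
  have nonzero x : x \in J -> c x != set0.
    move=> xJ; apply: contraTneq JZ => cx; apply/negP => /pred0P/(_ x).
    by rewrite /= xJ inE cx eqxx.
  have J_m I : #|J :&: fiber c I| = m (I1, I2) I.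
    rewrite -(cardsID U) -setIA [fiber c I :&: U]setIC setIA (setIidPr UJ).
    by rewrite mI1 -setIDAC mI2 /m doubleD.
  have I1_0 : I1 != set0 by rewrite I1x nonzero // (subsetP UJ).
  have I2_0 : I2 != set0 by rewrite I2x nonzero //; move: x2D; rewrite inE => /andP[].
  (* The two halves play symmetric roles, so they are exchanged if their types come in the wrong
     order. *)
  case: (boolP (preceq prec I1 I2)) => [le12|].
    by exists (I1, I2); [rewrite /P I1_0 | apply/profileP].
  rewrite negb_or => /andP[n12 nlt12]; exists (I2, I1).
    by have := prec_total _ _ n12; rewrite /P I2_0 /preceq (negPf nlt12) /= => ->; rewrite orbT.
  by apply/profileP => I; rewrite J_m /m addnC.
move=> [[I1 I2] /andP[/= I1_0 le12] mJ]; have Jm := profileP _ _ mJ.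
have I2_0 : I2 != set0.
  move: le12; rewrite /preceq; have [<- //|_ /= lt12] := eqVneq I1 I2.
  apply/eqP => I20; rewrite I20 in lt12; have := prec_trans _ _ _ (prec0 _ I1_0) lt12.
  by rewrite prec_irr.
have J4 : #|J| = 4.
  rewrite card_fibers.
  transitivity (\sum_I ((I == I1).*2 + (I == I2).*2)).
    by apply: eq_bigr => I _; rewrite Jm /m doubleD.
  have sum1 I' : \sum_(I : {set 'I_k}) (I == I').*2 = 2.
    by rewrite (bigD1 I') //= eqxx big1 // => I /negPf->.
  by rewrite big_split /= !sum1.
split; rewrite ?J4 //.
(* Such a profile has two coordinates of the same type, which a minimal set of four excludes. *)
- apply/negP => minJ; have c_inj : {in J &, injective c}.
    by apply: min_zero_sum_type_inj; rewrite ?J4.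
  have : 1 < #|J :&: fiber c I1| by rewrite Jm /m /= eqxx; case: (I1 == I2).
  case/card_gt1P => x [y [/setIP[xJ]]]; rewrite inE => /eqP cx /setIP[yJ].
  by rewrite inE -cx => /eqP cy /eqP; case; apply: c_inj.
- by apply: zero_sum_even_profile mJ => I; rewrite odd_double.
- by rewrite disjoint_zero_fiber Jm /m /= !(eq_sym set0) (negPf I1_0) (negPf I2_0).
Qed.

End Counting.

(** * The families in [calA] as minimal zero-sum sets of characters *)

Lemma mem_calA k (prec : rel {set 'I_k}) p (t : p.-tuple {set 'I_k}) :
  (t \in calA prec p) =
    sorted (preceq prec) t && min_zero_sum (@indicator k \o tnth t) [set: 'I_p].
Proof.
have trivE S : trivial_subproduct t S = zero_sum (@indicator k \o tnth t) S.
  exact: trivial_character_sum.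
rewrite inE trivE /min_zero_sum; congr (_ && (_ && _)).
by apply: eq_forallb => S; rewrite trivE.
Qed.

(** For [p > 2] minimality makes the entries of a tuple distinct, and a sorted tuple without
    repetition is determined by its set of entries. *)
Lemma sum_calA k (prec : rel {set 'I_k}) p (q : {set 'I_k} -> nat) :
  subset_order prec -> 2 < p ->
  \sum_(t in calA prec p) \prod_(j < p) q (tnth t j) =
    \sum_(U : {set {set 'I_k}} | (#|U| == p) && min_zero_sum (@indicator k) U)
       \prod_(I in U) q I.
Proof.
case=> prec_irr prec_trans prec_total _ p2.
have le_trans : transitive (preceq prec).
  move=> J I K; rewrite /preceq => /predU1P[-> //|IJ] /predU1P[<-|JK].
    by rewrite IJ orbT.
  by rewrite (prec_trans _ _ _ IJ JK) orbT.
have le_anti : antisymmetric (preceq prec).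
  move=> I J /andP[/predU1P[//|IJ] /predU1P[//|JI]].
  by have := prec_trans _ _ _ IJ JI; rewrite prec_irr.
have le_total : total (preceq prec).
  move=> I J; rewrite /preceq eq_sym; have [//|/= IJ] := eqVneq J I.
  by apply: prec_total; rewrite eq_sym.
have tnth_set (t : p.-tuple {set 'I_k}) : tnth t @: [set: 'I_p] = [set:: t].
  apply/setP => I; rewrite inE; apply/imsetP/tnthP => [[j _ ->]|[j ->]]; by exists j.
have calA_inj t : t \in calA prec p -> {in [set: 'I_p] &, injective (tnth t)}.
  rewrite mem_calA => /andP[_ min_t]; apply: (@min_zero_sum_type_inj _ _ (tnth t)) min_t.
  by rewrite cardsT card_ord.
have calA_uniq t : t \in calA prec p -> uniq t.
  by move=> /calA_inj t_inj; apply/tuple_uniqP => i j; apply: t_inj; rewrite inE.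
pose f (t : p.-tuple {set 'I_k}) := [set:: t].
have f_inj : {in calA prec p &, injective f}.
  move=> t u tA uA /setP tu; apply/val_inj/(sorted_eq le_trans le_anti).
  - by move: tA; rewrite mem_calA => /andP[].
  - by move: uA; rewrite mem_calA => /andP[].
  apply: uniq_perm; rewrite ?calA_uniq // => I.
  by have := tu I; rewrite !inE.
rewrite [RHS](eq_bigl (mem (f @: calA prec p))) => [|U]; last first.
  apply/andP/imsetP => [[/eqP Up minU]|[t tA ->]].
    (* The tuple over [U] is its enumeration sorted by [preceq prec]. *)
    have size_t : size (sort (preceq prec) (enum U)) == p by rewrite size_sort -cardE Up.
    have tU : f (Tuple size_t) = U by apply/setP => I; rewrite inE mem_sort mem_enum.
    exists (Tuple size_t) => //; rewrite mem_calA sort_sorted //=.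
    rewrite -min_zero_sum_imset ?tnth_set -/(f _) ?tU // => i j _ _.
    by apply/tuple_uniqP; rewrite /= sort_uniq enum_uniq.
  rewrite /f -tnth_set card_in_imset ?min_zero_sum_imset; try exact: calA_inj.
  by rewrite cardsT card_ord eqxx; move: tA; rewrite mem_calA => /andP[].
rewrite big_imset //=; apply: eq_bigr => t tA; rewrite -(big_tuple _ _ t predT).
rewrite /f big_uniq ?calA_uniq //=; apply: eq_bigl => I; first by rewrite inE.
Qed.

(** * Explicit enumeration of the minimal sets of four characters for k = 3 *)

Fixpoint subseqs (A : Type) (s : seq A) : seq (seq A) :=
  if s is x :: s' then subseqs s' ++ [seq x :: l | l <- subseqs s'] else [:: [::]].

Lemma subseqs_map (A B : Type) (f : A -> B) s :
  subseqs [seq f x | x <- s] = [seq [seq f x | x <- l] | l <- subseqs s].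
Proof.
elim: s => //= x s ->; rewrite map_cat -!map_comp; congr (_ ++ _).
Qed.

Lemma mem_subseqs (A : eqType) (s l : seq A) : l \in subseqs s -> subseq l s.
Proof.
elim: s l => [|x s IHs] l /=; first by rewrite inE => /eqP->.
rewrite mem_cat => /orP[/IHs ls|/mapP[l' /IHs l's ->]]; last by rewrite /= eqxx.
exact: subseq_trans ls (subseq_cons _ _).
Qed.

(** This turns a sum over subsets into one over a computable list. Separating the subsets that
    contain [x] from the others follows the recursion of [subseqs]. *)
Lemma sum_subsets (L : finType) (s : seq L) (F : {set L} -> nat) : uniq s ->
  \sum_(U : {set L} | U \subset [set:: s]) F U = \sum_(l <- subseqs s) F [set:: l].
Proof.
elim: s F => [|x s IHs] F /=.
  move=> _; rewrite big_seq1 (eq_bigl (pred1 set0)) ?big_pred1_eq => [|U].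
    by congr F; apply/setP => y; rewrite !inE.
  by rewrite (_ : [set:: [::]] = set0) ?subset0 //; apply/setP => y; rewrite !inE.
case/andP => xs us; rewrite big_cat big_map -(IHs F) //=.
under [X in _ = _ + X]eq_bigr do rewrite set_cons.
rewrite -(IHs (fun U => F (x |: U))) // set_cons.
have xNs (U : {set L}) : U \subset [set:: s] -> x \notin U.
  by move=> Us; apply: contra xs => xU; have := subsetP Us x xU; rewrite inE.
rewrite (bigID (fun U : {set L} => x \in U)) /= addnC; congr (_ + _).
  apply: eq_bigl => U; apply/andP/idP => [[Us xU]|Us]; last first.
    by rewrite (subset_trans Us) ?subsetUr ?xNs.
  apply/subsetP => y yU; have := subsetP Us y yU; rewrite !inE => /predU1P[yx|//].
  by rewrite -yx yU in xU.
rewrite (reindex_onto (fun U => x |: U) (fun U => U :\ x)) /=; last first.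
  by move=> U /andP[_ xU]; rewrite setD1K.
apply: eq_bigl => U; rewrite setU11 andbT.
apply/andP/idP => [[/subsetP Us /eqP xU]|Us]; last first.
  by rewrite setUS // setU1K ?xNs.
apply/subsetP => y yU; have : y \in x |: [set:: s] by apply: Us; rewrite inE yU orbT.
by rewrite !inE => /predU1P[yx|//]; move: yU; rewrite -xU yx !inE eqxx.
Qed.

Lemma natr_Z2_eq0 m : (m%:R == 0 :> 'Z_2)%R = ~~ odd m.
Proof. by rewrite -val_eqE /= val_Zp_nat // modn2; case: (odd m). Qed.

(** A proper zero-sum part would be a pair of equal vectors, but the members of [U] are distinct. *)
Lemma min_zero_sum4 k (U : {set {set 'I_k}}) : #|U| = 4 ->
  min_zero_sum (@indicator k) U = zero_sum (@indicator k) U && (set0 \notin U).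
Proof.
move=> U4; have UZ : [disjoint U & fiber id (set0 : {set 'I_k})] = (set0 \notin U).
  rewrite disjoint_sym (eq_disjoint (B := pred1 set0)) ?disjoint1 // => I.
  by rewrite !inE.
apply/idP/andP => [minU|[zU U0]].
  by rewrite -UZ; split; [case/andP: minU | apply: min_zero_sum_disjoint; rewrite ?U4].
apply/min_zero_sumP; split=> // W W0 WU zW; apply/eqP/negPn/negP => neqW.
have prW : W \proper U by rewrite properEneq neqW.
have W2 : #|W| == 2.
  rewrite -UZ in U0; have := @proper_zero_sum_card _ _ id _ _ U0 zU W0 prW zW.
  by rewrite U4; case: #|W| => [|[|[|[]]]].
move: zW; case/cards2P: W2 => x [y [xy ->]].
rewrite zero_sum2 //; last exact: addvv_Z2.
by rewrite (inj_eq (@indicator_inj k)) (negPf xy).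
Qed.

(** The shape is that of [qs], so that [q (decode l)] is [qs q l] by conversion. *)
Definition decode (l : seq nat) : {set 'I_3} := [set i : 'I_3 | i.+1 \in l].

Definition codes : seq (seq nat) :=
  [:: [::]; [:: 1]; [:: 2]; [:: 3]; [:: 1; 2]; [:: 1; 3]; [:: 2; 3]; [:: 1; 2; 3]].

Lemma uniq_decode : uniq [seq decode l | l <- codes].
Proof.
(* The membership vectors of the eight sets are distinct by computation. *)
pose g (I : {set 'I_3}) :=
  [:: @Ordinal 3 0 isT \in I; @Ordinal 3 1 isT \in I; @Ordinal 3 2 isT \in I].
by apply: (@map_uniq _ _ g); rewrite -map_comp /g /= !inE.
Qed.

Lemma set_decode : [set:: [seq decode l | l <- codes]] = setT.
Proof.
apply/eqP; rewrite eqEcard subsetT /= -powersetT card_powerset cardsT card_ord.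
by rewrite cardsE (card_uniqP uniq_decode).
Qed.

(** Minimality of four characters becomes a decidable condition on index lists: the trivial
    character is absent and each index occurs an even number of times. The right side then reduces
    to an explicit sum. *)
Lemma num_min_rank3 (q : {set 'I_3} -> nat) :
  \sum_(U : {set {set 'I_3}} | (#|U| == 4) && min_zero_sum (@indicator 3) U)
     \prod_(I in U) q I =
  \sum_(l <- [seq l <- subseqs codes | [&& size l == 4, [::] \notin l
      & all (fun i => ~~ odd (count (fun x : seq nat => i \in x) l)) [:: 1; 2; 3]]])
    \prod_(x <- l) qs q x.
Proof.
rewrite big_mkcond (eq_bigl (fun U : {set {set 'I_3}} =>
  U \subset [set:: [seq decode l | l <- codes]])); last first.
  by move=> U; rewrite set_decode subsetT.
rewrite sum_subsets ?uniq_decode // subseqs_map big_map [RHS]big_filter [RHS]big_mkcond.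
rewrite big_seq [RHS]big_seq; apply: eq_bigr => l /mem_subseqs l_codes.
have ul : uniq [seq decode x | x <- l].
  exact: subseq_uniq (map_subseq _ l_codes) uniq_decode.
have -> : #|[set:: [seq decode x | x <- l]]| = size l.
  by rewrite cardsE (card_uniqP ul) size_map.
have -> : \prod_(I in [set:: [seq decode x | x <- l]]) q I = \prod_(x <- l) qs q x.
  rewrite -[RHS](big_map decode predT) big_uniq //=.
  by apply: eq_bigl => I; rewrite inE.
case: eqP => //= l4.
rewrite min_zero_sum4 ?cardsE ?(card_uniqP ul) ?size_map // andbC; congr (if _ && _ then _ else _).
  rewrite inE; congr (~~ _); apply/mapP/idP => [[x xl x0]|]; last first.
    by move=> l0; exists [::] => //; apply/setP => i; rewrite !inE.
  have xc := mem_subseq l_codes xl.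
  have xN i : i < 3 -> i.+1 \notin x.
    by move=> i3; have /setP/(_ (Ordinal i3)) := x0; rewrite !inE => <-.
  (* By inspection of the eight codes, only the empty list decodes to the empty set. *)
  have := allP (isT : all (fun x => (x == [::]) || has (mem x) [:: 1; 2; 3]) codes) x xc.
  by case/predU1P => [<- //|/=]; rewrite !(negPf (xN _ _)).
rewrite /zero_sum (eq_bigl (mem [seq decode x | x <- l])) => [|I]; last by rewrite inE.
rewrite -big_uniq // big_map.
(* A coordinate of the sum is the number, modulo 2, of lists containing the corresponding index. *)
have sumE i : ((\sum_(x <- l) indicator (decode x)) 0 i == 0 :> 'Z_2)%R
    = ~~ odd (count (fun x : seq nat => i.+1 \in x) l).
  rewrite summxE -natr_Z2_eq0 -sum1_count natr_sum [X in _ = (X == _)]big_mkcond /=.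
  congr (_ == _).
  by apply: eq_bigr => x _; rewrite mxE inE; case: (_ \in x).
rewrite /= -(sumE (@Ordinal 3 0 isT)) -(sumE (@Ordinal 3 1 isT)) -(sumE (@Ordinal 3 2 isT)).
apply/eqP/idP => [->|]; first by rewrite !mxE eqxx.
case/and4P => /eqP S1 /eqP S2 /eqP S3 _; apply/rowP => -[[|[|[|//]]] i3]; rewrite [RHS]mxE.
- by rewrite -[RHS]S1; congr (fun_of_matrix _ _ _); apply/val_inj.
- by rewrite -[RHS]S2; congr (fun_of_matrix _ _ _); apply/val_inj.
- by rewrite -[RHS]S3; congr (fun_of_matrix _ _ _); apply/val_inj.
Qed.

(** * Assembly of the formulas for primitive and Betti numbers *)

Theorem proposition2p3 (k n : nat) (prec : rel {set 'I_k})
    (q : {set 'I_k} -> nat) (rho : 'rV['Z_2]_k -> 'M[int]_n)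
    (hprec : subset_order prec) (hrho : diagonal_rep rho)
    (hq : rep_sum prec q rho) :
  let P := num_primitive (codom rho) in
  let beta := betti (codom rho) in
  let q0 := q set0 in
  [/\ P 0 = 1,
      P 1 = q0,
      P 2 = \sum_(I : {set 'I_k} | I != set0) 'C(q I, 2),
      (forall p, 3 <= p <= k ->
        P p = \sum_(t in calA prec p) \prod_(j < p) q (tnth t j))
    & (forall p, k.+1 < p -> P p = 0)]
  /\ (k = 3 ->
      P 4 = qs q [:: 1] * qs q [:: 2] * qs q [:: 3] * qs q [:: 1; 2; 3]
          + qs q [:: 1] * qs q [:: 2] * qs q [:: 1; 3] * qs q [:: 2; 3]
          + qs q [:: 1] * qs q [:: 3] * qs q [:: 1; 2] * qs q [:: 2; 3]
          + qs q [:: 1] * qs q [:: 1; 2] * qs q [:: 1; 3] * qs q [:: 1; 2; 3]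
          + qs q [:: 2] * qs q [:: 3] * qs q [:: 1; 2] * qs q [:: 1; 3]
          + qs q [:: 2] * qs q [:: 1; 2] * qs q [:: 2; 3] * qs q [:: 1; 2; 3]
          + qs q [:: 3] * qs q [:: 1; 3] * qs q [:: 2; 3] * qs q [:: 1; 2; 3])
  /\ [/\ beta 0 = P 0 /\ P 0 = 1,
         beta 1 = P 1,
         beta 2 = 'C(q0, 2) + P 2,
         beta 3 = 'C(q0, 3) + q0 * P 2 + P 3
       & beta 4 = \sum_(I : {set 'I_k} | I != set0) 'C(q I, 4)
                + \sum_(I1 : {set 'I_k} | I1 != set0)
                    \sum_(I2 : {set 'I_k} | prec I1 I2)
                      'C(q I1, 2) * 'C(q I2, 2)
                + q0 * P 3 + 'C(q0, 2) * P 2 + 'C(q0, 4) + P 4]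
  /\ (q0 = 0 /\ beta 1 = 0 ->
      [/\ beta 2 = P 2,
          beta 3 = P 3
        & beta 4 = \sum_(I : {set 'I_k} | I != set0) 'C(q I, 4)
                 + \sum_(I1 : {set 'I_k} | I1 != set0)
                     \sum_(I2 : {set 'I_k} | prec I1 I2)
                       'C(q I1, 2) * 'C(q I2, 2)
                 + P 4]).
Proof.
have [c [rhoE cardE]] := rep_sum_types hq.
move=> P beta q0.
have PE p : P p = num_min c p.
  by apply: eq_card => J; rewrite !inE (primitiveE rhoE).
have betaE p : beta p = num_zero c p := bettiE rhoE p.
have P2E : P 2 = num_zero_reduced c 2 by rewrite PE num_min_reduced.
have P3E : P 3 = num_zero_reduced c 3 by rewrite PE num_min_reduced.
have P_types p : 2 < p -> P p =
    \sum_(U : {set {set 'I_k}} | (#|U| == p) && min_zero_sum (@indicator k) U)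
       \prod_(I in U) q I.
  move=> p2; rewrite PE num_min_types //.
  by apply: eq_bigr => U _; apply: eq_bigr => I _.
have P1E : P 1 = q0 by rewrite PE num_min1 cardE.
(* In this and the next three expansions over the number of trivial coordinates, the term with a
   single nontrivial coordinate vanishes and the one with none is a pure binomial in [q0]. *)
have beta1 : beta 1 = q0.
  by rewrite betaE num_zeroE !big_nat_recr ?big_geq //= !subSS !subn0
    num_zero_reduced1 num_zero_reduced0 bin1 cardE; lia.
have beta2 : beta 2 = 'C(q0, 2) + P 2.
  rewrite betaE num_zeroE !big_nat_recr ?big_geq //= !subSS !subn0 P2E.
  by rewrite ?subnn num_zero_reduced1 num_zero_reduced0 bin0 bin1 cardE -/q0; lia.
have beta3 : beta 3 = 'C(q0, 3) + q0 * P 2 + P 3.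
  rewrite betaE num_zeroE !big_nat_recr ?big_geq //= !subSS !subn0 P2E P3E.
  by rewrite ?subnn num_zero_reduced1 num_zero_reduced0 bin0 bin1 cardE -/q0; lia.
have beta4 : beta 4 = \sum_(I : {set 'I_k} | I != set0) 'C(q I, 4)
    + \sum_(I1 : {set 'I_k} | I1 != set0)
        \sum_(I2 : {set 'I_k} | prec I1 I2) 'C(q I1, 2) * 'C(q I2, 2)
    + q0 * P 3 + 'C(q0, 2) * P 2 + 'C(q0, 4) + P 4.
  rewrite betaE num_zeroE !big_nat_recr ?big_geq //= !subSS !subn0 P2E P3E (PE 4).
  rewrite ?subnn num_zero_reduced1 num_zero_reduced0 (num_zero_reduced4 c hprec) bin0 bin1 cardE.
  under [\sum_(I | _) 'C(#|_|, 4)]eq_bigr do rewrite cardE.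
  under [\sum_(I1 | _) \sum_(I2 | _) 'C(#|_|, _) * _]eq_bigr do under eq_bigr do rewrite !cardE.
  rewrite -/q0; ring.
split; [split|split; [|split; [split|]]] => //.
- by rewrite PE num_min0.
- rewrite P2E num_zero_reduced2.
  by apply: eq_bigr => I _; rewrite cardE.
- by move=> p /andP[p3 _]; rewrite P_types // sum_calA.
- by move=> p kp; rewrite PE num_min_gt.
(* Degree 4 is k + 1 here, where the formula by sets of types still holds. *)
- move=> k3; rewrite P_types //.
  move: q {hprec hq c rhoE cardE PE betaE P2E P3E P_types P1E beta1 beta2 beta3 beta4
    P beta rho hrho prec q0}.
  subst k => q; rewrite num_min_rank3 /= !big_cons !big_nil; lia.
- by rewrite PE betaE num_zeroE !big_nat_recr ?big_geq //= subnn num_min0 num_zero_reduced0 bin0.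
- by rewrite P1E.
- case=> q00 _; rewrite beta2 beta3 beta4 q00; split; rewrite ?bin0n ?mul0n ?add0n ?addn0 //.
Qed.
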